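(* Let $n\ge1$, $M\ge2$, let $\mathbf{s}_1,\dots,\mathbf{s}_M\in\mathbb{R}^n$ be any distinct points with $\frac1M\sum_{k=1}^M|\mathbf{s}_k|^2=1$, with any bit mapping (assignment of binary sequences to the points) and any prior probabilities $\Pr\{\mathbf{s}=\mathbf{s}_i\}$ not depending on the noise power. Then the bit error rate BER of the maximum likelihood detector in the AWGN channel is a convex function of the noise power $P_N=\sigma_0^2$ in the small noise/high SNR mode $$0<P_N\le d_{\min}^2\left(n+2+\sqrt{2(n+2)}\right)^{-1},$$ where $d_{\min}=\min_i d_{\min,i}$ is the minimum distance to the decision region boundary in the constellation.
   Context: Channel model: $\mathbf{r}=\mathbf{s}+\boldsymbol{\xi}$ in $\mathbb{R}^n$, where $\mathbf{s}\in\{\mathbf{s}_1,\dots,\mathbf{s}_M\}$ is the transmitted constellation point and $\boldsymbol{\xi}\sim\mathcal{N}(\mathbf{0},\sigma_0^2\mathbf{I})$ is independent Gaussian noise with density $p_\xi(\mathbf{x})=(2\pi\sigma_0^2)^{-n/2}e^{-|\mathbf{x}|^2/(2\sigma_0^2)}$; $|\cdot|$ is the Euclidean norm. The noise power is $P_N=\sigma_0^2$. The constellation is fixed and $P_N$ varies. (Coding under maximum likelihood decoding is included by regarding codewords as points of an extended constellation.) The maximum likelihood detector is the minimum distance detector $\hat{\mathbf{s}}=\arg\min_{\mathbf{s}_k}|\mathbf{r}-\mathbf{s}_k|$ (ties have probability zero). The decision (Voronoi) region of $\mathbf{s}_k$ is $V_k=\{\mathbf{y}\in\mathbb{R}^n: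 |\mathbf{y}-\mathbf{s}_k|\le|\mathbf{y}-\mathbf{s}_l|\ \text{for all } l\}$. The pairwise error probability is $\Pr\{\mathbf{s}_i\to\mathbf{s}_j\}=\Pr[\hat{\mathbf{s}}=\mathbf{s}_j\mid\mathbf{s}=\mathbf{s}_i]=\int_{V_j-\mathbf{s}_i}p_\xi(\mathbf{x})\,d\mathbf{x}$ for $i\ne j$. The bit error rate is $$\mathrm{BER}=\sum_{i=1}^M\sum_{j\ne i}\frac{h_{ij}}{\log_2 M}\Pr\{\mathbf{s}=\mathbf{s}_i\}\Pr\{\mathbf{s}_i\to\mathbf{s}_j\},$$ where $h_{ij}$ is the Hamming distance between the binary sequences (of common length) representing $\mathbf{s}_i$ and $\mathbf{s}_j$. $d_{\min,i}$ is the minimum distance from $\mathbf{s}_i$ to the boundary of $V_i$, i.e. $d_{\min,i}=\frac12\min_{l\ne i}|\mathbf{s}_l-\mathbf{s}_i|$. *)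

(* Defs.v *)
From HB Require Import structures.
From mathcomp Require Import all_boot all_order all_algebra.
From mathcomp Require Import all_classical all_reals all_analysis.

Set Implicit Arguments.
Unset Strict Implicit.
Unset Printing Implicit Defensive.

Import Order.TTheory GRing.Theory Num.Theory.
Import numFieldNormedType.Exports.

Local Open Scope classical_set_scope.
Local Open Scope ring_scope.

(* R^n is represented by n.-tuple R: MathComp-Analysis equips tuples (and not *)
(* row vectors) with the product sigma-algebra, here the Borel sigma-algebra. *)
(* The library has only binary product measures, so Lebesgue measure on R^n   *)
(* is built by induction on n; lebesgue_tuple_box below checks it on boxes.   *)
Section cons_measure.
Context {R : realType} (n : nat).

Definition tuple_cons (p : R * n.-tuple R) : n.+1.-tuple R :=
  [tuple of p.1 :: p.2].

Lemma measurable_tuple_cons :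
  measurable_fun [set: R * n.-tuple R] tuple_cons.
Proof.
by apply: measurable_cons; [exact: measurable_fst|exact: measurable_snd].
Qed.

Variable mu : {sigma_finite_measure set (n.-tuple R) -> \bar R}.

Definition cons_measure : set (n.+1.-tuple R) -> \bar R :=
  pushforward (@lebesgue_measure R \x mu)%E tuple_cons.

Let cons_measure0 : cons_measure set0 = 0%E.
Proof. by rewrite /cons_measure /pushforward preimage_set0 measure0. Qed.

Let cons_measure_ge0 A : (0 <= cons_measure A)%E.
Proof. by rewrite /cons_measure /pushforward measure_ge0. Qed.

Let cons_measure_sigma_additive : semi_sigma_additive cons_measure.
Proof.
move=> F mF tF mUF; rewrite /cons_measure /pushforward preimage_bigcup.
apply: measure_semi_sigma_additive.
- by move=> k; rewrite -[X in measurable X]setTI; exact: measurable_tuple_cons.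
- apply/trivIsetP => /= i j _ _ ij; rewrite -preimage_setI.
  by move/trivIsetP : tF => /(_ _ _ _ _ ij) ->//; rewrite preimage_set0.
- rewrite -preimage_bigcup -[X in measurable X]setTI.
  exact: measurable_tuple_cons.
Qed.

HB.instance Definition _ := isMeasure.Build _ _ _ cons_measure
  cons_measure0 cons_measure_ge0 cons_measure_sigma_additive.

Let cons_measure_sigma_finite : sigma_finite setT cons_measure.
Proof.
have /sigma_finiteP[F [FT ndF Foo]] := sigma_finiteT (@lebesgue_measure R).
have /sigma_finiteP[G [GT ndG Goo]] := sigma_finiteT mu.
pose g (t : n.+1.-tuple R) : R * n.-tuple R := (thead t, [tuple of behead t]).
have gK : cancel tuple_cons g by move=> [a t]; congr pair; apply: val_inj.
have mg : measurable_fun [set: n.+1.-tuple R] g.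
  apply: measurable_fun_pair; first exact: measurable_tnth.
  exact: measurable_behead.
exists (fun k => g @^-1` (F k `*` G k)).
  apply/seteqP; split => // t _.
  have [i _ Fi] : (\bigcup_i F i) (g t).1 by rewrite -FT.
  have [j _ Gj] : (\bigcup_j G j) (g t).2 by rewrite -GT.
  exists (maxn i j) => //; split.
    by move: (g t).1 Fi; exact/subsetPset/ndF/leq_maxl.
  by move: (g t).2 Gj; exact/subsetPset/ndG/leq_maxr.
move=> k; have [mF Fk] := Foo k; have [mG Gk] := Goo k; split.
  by rewrite -[X in measurable X]setTI; apply: mg => //; exact: measurableX.
rewrite /cons_measure /pushforward -comp_preimage.
rewrite (_ : g \o tuple_cons = id); last by apply/funext => p /=; rewrite gK.
by rewrite preimage_id product_measure1E// lte_mul_pinfty// ge0_fin_numE.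
Qed.

HB.instance Definition _ := Measure_isSigmaFinite.Build _ _ _ cons_measure
  cons_measure_sigma_finite.

End cons_measure.

Fixpoint lebesgue_tuple (R : realType) (n : nat) :
    {sigma_finite_measure set (n.-tuple R) -> \bar R} :=
  match n with
  | 0 => \d_[tuple]
  | m.+1 => cons_measure (lebesgue_tuple R m)
  end.

Lemma lebesgue_tuple_box (R : realType) (n : nat) (A : 'I_n -> set R) :
  (forall i, measurable (A i)) ->
  lebesgue_tuple R n [set t | forall i, A i (tnth t i)] =
  (\prod_(i < n) lebesgue_measure (A i))%E.
Proof.
elim: n A => [|n IHn] A mA.
  by rewrite big_ord0 /= diracE mem_set //= => -[].
have mB : measurable [set t : n.-tuple R | forall i : 'I_n, A (lift ord0 i) (tnth t i)].
  rewrite [X in measurable X](_ : _ =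
      \bigcap_(i in [set: 'I_n]) (fun t => tnth t i) @^-1` A (lift ord0 i)).
    apply: fin_bigcap_measurable => // i _.
    by rewrite -[X in measurable X]setTI; exact: measurable_tnth.
  by apply/seteqP; split => [t tA i _|t tA i]; [exact: tA|exact: (tA i)].
rewrite big_ord_recl -IHn//.
have mA0 := mA ord0.
rewrite -[RHS](product_measure1E (@lebesgue_measure R) (lebesgue_tuple R n)
  mA0 mB).
rewrite /= /cons_measure /pushforward; apply: congr1.
apply/seteqP; split => -[a t] /=.
  by move=> At; split => [|i]; [exact: (At ord0)|
    have := At (lift ord0 i); rewrite tnthS].
by move=> [A0 At] i; case: (unliftP ord0 i) => [j|] ->//; rewrite tnthS.
Qed.

Section euclidean.
Context {R : realType} {n : nat}.
Implicit Types x y : n.-tuple R.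

Definition vsub x y : n.-tuple R := [tuple tnth x k - tnth y k | k < n].

Definition enorm x : R := Num.sqrt (\sum_(k < n) tnth x k ^+ 2).

End euclidean.

Definition hamming (m : nat) (b c : m.-tuple bool) : nat :=
  #|[set k : 'I_m | tnth b k != tnth c k]%SET|.

(* density of N(0, P I), as a function of the noise power P = sigma_0^2 *)
Definition noise_pdf (R : realType) (n : nat) (P : R) (x : n.-tuple R) : R :=
  (2 * pi * P) `^ (- (n%:R / 2)) * expR (- (enorm x ^+ 2 / (2 * P))).

Section detector.
Context {R : realType} {n M : nat}.
Variable s : 'I_M -> n.-tuple R.

Definition voronoi (k : 'I_M) : set (n.-tuple R) :=
  [set y | forall l, enorm (vsub y (s k)) <= enorm (vsub y (s l))].

Definition pairwise_error (i j : 'I_M) (P : R) : R :=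
  \int[lebesgue_tuple R n]_(x in [set vsub y (s i) | y in voronoi j])
    noise_pdf P x.

Definition BER (m : nat) (bits : 'I_M -> m.-tuple bool) (prior : 'I_M -> R)
    (P : R) : R :=
  \sum_(i < M) \sum_(j < M | j != i)
    (hamming (bits i) (bits j))%:R / (ln M%:R / ln 2) *
      prior i * pairwise_error i j P.

(* Both infima are over finite sets, nonempty when M >= 2, so are minima. *)
Definition dmin_at (i : 'I_M) : R :=
  2^-1 * inf [set enorm (vsub (s l) (s i)) | l in [set l | l != i]].

Definition dmin : R := inf [set dmin_at i | i in [set: 'I_M]].

End detector.

(* Main.v *)
Require Import Defs.
From mathcomp Require Import all_boot all_order all_algebra.
From mathcomp Require Import all_classical all_reals all_analysis.
From mathcomp Require Import measurable_realfun ring lra.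

Import Order.TTheory GRing.Theory Num.Theory.
Import numFieldNormedType.Exports.

Local Open Scope classical_set_scope.
Local Open Scope ring_scope.

(* For fixed x, the Gaussian density at x, as a function of the noise power   *)
(* P, is a constant times exp (- (n/2) ln P - (|x|^2/2) / P), which is convex *)
(* on 0 < P <= |x|^2 / (n + 2 + sqrt (2 (n + 2))). An erroneous decision      *)
(* s_i -> s_j requires |y - s_j| <= |y - s_i|, which forces the noise         *)
(* x = y - s_i to satisfy |x| >= |s_j - s_i| / 2 >= dmin. Hence on the stated *)
(* range of P every error probability integrates functions convex in P, and   *)
(* the BER is a nonnegative combination of these probabilities.               *)

(** The bound on P comes from the sign of a second derivative: with k = n/2, c = |x|^2/2 and t = c/P
    it is that of (t - k - 1)^2 - (k + 1), nonnegative once t >= k + 1 + sqrt (k + 1)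
    ([convex_exp_ln_inv], [convex_noise_pdf]). By [dmin_le_enorm] one range of P serves every noise
    vector causing an error, and [convex_pairwise_error] integrates the pointwise inequality, using
    [integrable_noise_pdf]. *)

Section exp_ln_inv.
Context {R : realType}.
Implicit Types k c x a b : R.

(** For x > 0 this is x^(-k) exp (- c/x). As a single exponential, its derivative is itself times
    that of the exponent. *)
Definition exp_ln_inv k c x : R := expR (- k * ln x - c * x^-1).

Lemma is_derive_inv x : 0 < x -> is_derive x 1 (@GRing.inv R) (- x^-1 ^+ 2).
Proof.
move=> x0; apply: is_derive_eq; first by apply: is_deriveV; rewrite gt_eqF.
by rewrite scaler1 exprVn.
Qed.

Lemma is_derive_exp_ln_inv k c x : 0 < x ->
  is_derive x 1 (exp_ln_inv k c)
    ((c * x^-1 ^+ 2 - k * x^-1) * exp_ln_inv k c x).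
Proof.
move=> x0; have dl := is_derive1_ln x0; have dV := is_derive_inv _ x0.
by apply: is_derive_eq; rewrite /GRing.scale /= /exp_ln_inv; ring.
Qed.

Lemma is_derive2_exp_ln_inv k c x : 0 < x ->
  is_derive x 1 ('D_1 (exp_ln_inv k c))
    (x^-1 ^+ 2 * ((c / x - k) ^+ 2 + k - 2 * (c / x)) * exp_ln_inv k c x).
Proof.
move=> x0; have dV := is_derive_inv _ x0.
have df := is_derive_exp_ln_inv k c _ x0.
pose g y := (c * y^-1 ^+ 2 - k * y^-1) * exp_ln_inv k c y.
(* The closed form of the first derivative is known at positive points only, hence near x, which
   suffices to differentiate again. *)
have gE : \near x, g x = 'D_1 (exp_ln_inv k c) x.
  near=> y; have y0 : 0 < y by near: y; exact: lt_nbhsr.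
  by have df' := is_derive_exp_ln_inv k c _ y0; rewrite derive_val.
have dg : is_derive x 1 g
    (x^-1 ^+ 2 * ((c / x - k) ^+ 2 + k - 2 * (c / x)) * exp_ln_inv k c x).
  by apply: is_derive_eq; rewrite /GRing.scale /=; ring.
split; first by apply: near_eq_derivable gE _.
by rewrite -(near_eq_derive _ gE) derive_val.
Unshelve. all: by end_near. Qed.

Local Open Scope convex_scope.

(* With t = c / x, the second derivative has the sign of                      *)
(* (t - k)^2 + k - 2 t = (t - k - 1)^2 - (k + 1).                             *)
Lemma convex_exp_ln_inv k c (a b : R^o) (t : {i01 R}) :
  0 <= k -> 0 < a -> a <= b -> k + 1 + Num.sqrt (k + 1) <= c / b ->
  exp_ln_inv k c (a <| t |> b : R^o)
    <= (exp_ln_inv k c a : R^o) <| t |> (exp_ln_inv k c b : R^o).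
Proof.
move=> k0 a0 ab ckb.
have cf (x : R) : 0 < x -> {for x, continuous (exp_ln_inv k c)}.
  move=> x0; apply: differentiable_continuous; apply/derivable1_diffP.
  by have df := is_derive_exp_ln_inv k c _ x0.
have gt0_itv (x : R) : x \in `]a, b[ -> 0 < x.
  by rewrite in_itv /= => /andP[ax _]; exact: lt_trans ax.
apply: second_derivative_convex => //.
- move=> x /andP[ax xb]; have x0 := lt_trans a0 ax.
  have df := is_derive2_exp_ln_inv k c _ x0; rewrite derive_val.
  rewrite mulr_ge0 ?expR_ge0// mulr_ge0 ?sqr_ge0//.
  have b0 := lt_trans x0 xb.
  (* The bound at b forces c >= 0, so c / x decreases in x and the bound at b holds on all of the
     interval. *)
  have c0 : 0 <= c.
    rewrite -(pmulr_lge0 _ (_ : 0 < b^-1)) ?invr_gt0//.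
    by rewrite (le_trans _ ckb)// addr_ge0 ?sqrtr_ge0// addr_ge0.
  have cbx : c / b <= c / x by rewrite ler_wpM2l// lef_pV2 ?posrE// ltW.
  have sq : Num.sqrt (k + 1) ^+ 2 = k + 1 by rewrite sqr_sqrtr// addr_ge0.
  have := sqrtr_ge0 (k + 1); nra.
- by apply: cvg_at_left_filter; apply: cf; exact: lt_le_trans ab.
- by apply: cvg_at_right_filter; exact: cf.
- by move=> x /gt0_itv x0; have df := is_derive_exp_ln_inv k c _ x0.
- by move=> x /gt0_itv x0; have df := is_derive2_exp_ln_inv k c _ x0.
Qed.

End exp_ln_inv.

(** * Integrability of the Gaussian density on R^n *)

Lemma enormE (R : realType) n (x : n.-tuple R) :
  enorm x ^+ 2 = \sum_(k < n) tnth x k ^+ 2.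
Proof. by rewrite sqr_sqrtr// sumr_ge0// => k _; rewrite sqr_ge0. Qed.

Lemma enorm_ge0 (R : realType) n (x : n.-tuple R) : 0 <= enorm x.
Proof. exact: sqrtr_ge0. Qed.

Lemma enorm_tuple_cons (R : realType) n (p : R * n.-tuple R) :
  enorm (tuple_cons p) ^+ 2 = p.1 ^+ 2 + enorm p.2 ^+ 2.
Proof.
rewrite !enormE big_ord_recl; congr (_ + _).
by apply: eq_bigr => i _; rewrite tnthS.
Qed.

Lemma measurable_enorm (R : realType) n :
  measurable_fun [set: n.-tuple R] (@enorm R n).
Proof.
apply: measurableT_comp.
  by apply: continuous_measurable_fun; exact: sqrt_continuous.
by apply: measurable_sum => i; apply: measurable_funX; exact: measurable_tnth.
Qed.

Lemma integral_gauss1_lty (R : realType) P : 0 < P ->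
  (\int[@lebesgue_measure R]_x (expR (- (x ^+ 2 / (2 * P))))%:E < +oo)%E.
Proof.
move=> P0; set s := Num.sqrt P.
have s0 : s != 0 by rewrite gt_eqF// sqrtr_gt0.
have pk := normal_peak_gt0 s0.
have gE x : expR (- (x ^+ 2 / (2 * P))) = (normal_peak s)^-1 * normal_pdf 0 s x.
  rewrite normal_pdfE// mulKf ?gt_eqF// /normal_fun.
  by rewrite subr0 sqr_sqrtr ?ltW// mulNr mulr_natl.
under eq_integral do rewrite gE EFinM.
rewrite ge0_integralZl_EFin//=.
- by rewrite integral_normal_pdf mule1 ltry.
- by move=> x _; rewrite lee_fin normal_pdf_ge0.
- by apply/measurable_EFinP; exact: measurable_normal_pdf.
- by rewrite invr_ge0 ltW.
Qed.

Lemma measurable_gauss (R : realType) n (P : R) :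
  measurable_fun [set: n.-tuple R] (fun x => expR (- (enorm x ^+ 2 / (2 * P)))).
Proof.
apply: measurableT_comp => //; apply: measurableT_comp => //.
apply: measurable_funM => //; apply: measurable_funX.
exact: measurable_enorm.
Qed.

Lemma measurable_gauss1 (R : realType) (P : R) :
  measurable_fun [set: R] (fun x => expR (- (x ^+ 2 / (2 * P)))).
Proof.
apply: measurableT_comp => //; apply: measurableT_comp => //.
by apply: measurable_funM => //; exact: measurable_funX.
Qed.

(** The Gaussian factors over coordinates, so Tonelli and induction on n reduce it to dimension
    one. *)
Lemma integral_gauss_lty (R : realType) n P : 0 < P ->
  (\int[lebesgue_tuple R n]_x (expR (- (enorm x ^+ 2 / (2 * P))))%:E < +oo)%E.
Proof.
move=> P0.
pose g m (x : m.-tuple R) : \bar R := (expR (- (enorm x ^+ 2 / (2 * P))))%:E.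
have g0 m x : (0 <= g m x)%E by rewrite lee_fin expR_ge0.
have mg m : measurable_fun [set: m.-tuple R] (g m).
  by apply/measurable_EFinP; exact: measurable_gauss.
rewrite -/(g n); elim: n => [|n IHn].
  by rewrite /= integral_dirac ?diracT ?mul1e ?ltry//; exact: mg.
have mc := @measurable_tuple_cons R n.
have -> : (\int[lebesgue_tuple R n.+1]_x g n.+1 x =
    \int[@lebesgue_measure R \x lebesgue_tuple R n]_p g n.+1 (tuple_cons p))%E.
  (* True by computation: [lebesgue_tuple] at [n.+1] unfolds to this pushforward. *)
  transitivity (\int[pushforward (@lebesgue_measure R \x lebesgue_tuple R n)
      (@tuple_cons R n)]_x g n.+1 x)%E; first by [].
  by rewrite ge0_integral_pushforward//; exact: mg.
rewrite fubini_tonelli1//; last exact: measurableT_comp (mg n.+1) mc.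
rewrite /fubini_F/=.
have inner a : (\int[lebesgue_tuple R n]_t g n.+1 (tuple_cons (a, t)) =
    (expR (- (a ^+ 2 / (2 * P))))%:E * \int[lebesgue_tuple R n]_t g n t)%E.
  rewrite -ge0_integralZl//; last exact: mg.
  apply: eq_integral => t _.
  by rewrite /g enorm_tuple_cons mulrDl opprD expRD EFinM.
under eq_integral do rewrite inner.
rewrite ge0_integralZr//; last first.
- by apply: integral_ge0 => t _; exact: g0.
- by apply/measurable_EFinP; exact: measurable_gauss1.
rewrite lte_mul_pinfty ?integral_gauss1_lty//.
- by apply: integral_ge0 => x _; rewrite lee_fin expR_ge0.
- rewrite ge0_fin_numE ?integral_gauss1_lty//.
  by apply: integral_ge0 => x _; rewrite lee_fin expR_ge0.
Qed.

Lemma integrable_noise_pdf (R : realType) n (P : R) (A : set (n.-tuple R)) :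
  0 < P -> measurable A ->
  (lebesgue_tuple R n).-integrable A (EFin \o noise_pdf P).
Proof.
move=> P0 mA; apply: (integrableS measurableT) => //.
rewrite /noise_pdf /comp; under eq_fun do rewrite EFinM.
apply: integrableZl => //; apply/integrableP; split.
  by apply/measurable_EFinP; exact: measurable_gauss.
under eq_integral do rewrite gee0_abs ?lee_fin ?expR_ge0//.
exact: integral_gauss_lty.
Qed.

(** * Geometry of the decision regions *)

Lemma measurable_voronoi_shift (R : realType) n M (s : 'I_M -> n.-tuple R) i j :
  measurable [set vsub y (s i) | y in voronoi s j].
Proof.
pose vadd (x : n.-tuple R) := [tuple tnth x k + tnth (s i) k | k < n].
pose dist l (x : n.-tuple R) := enorm (vsub (vadd x) (s l)).
have mdist l : measurable_fun [set: n.-tuple R] (dist l).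
  apply: measurableT_comp; first exact: measurable_enorm.
  apply/measurable_fun_tnthP => k.
  rewrite (_ : _ \o _ = fun x => tnth x k + tnth (s i) k - tnth (s l) k).
    apply: measurable_funB => //; apply: measurable_funD => //.
    exact: measurable_tnth.
  by apply/funext => x /=; rewrite !tnth_mktuple.
(* Translating back by [vadd] turns the image into finitely many inequalities between measurable
   functions. *)
rewrite [X in measurable X](_ : _ =
    \bigcap_(l in [set: 'I_M]) [set x | dist j x <= dist l x]).
  apply: fin_bigcap_measurable => // l _.
  by rewrite -[X in measurable X]setTI; exact: measurable_fun_le.
apply/seteqP; split => [_ [y yV <-] l _|x xV].
  have yE : vadd (vsub y (s i)) = y.
    by apply: eq_from_tnth => k; rewrite !tnth_mktuple subrK.
  by rewrite /= /dist yE; exact: yV.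
exists (vadd x); first by move=> l; exact: xV.
by apply: eq_from_tnth => k; rewrite !tnth_mktuple addrK.
Qed.

Lemma inf_ge0 (R : realType) (A : set R) :
  (forall x, A x -> 0 <= x) -> 0 <= inf A.
Proof.
move=> A0; have [->|] := eqVneq A set0; first by rewrite inf0.
by move=> /set0P A1; exact: lb_le_inf.
Qed.

Lemma dmin_le_enorm (R : realType) n M (s : 'I_M -> n.-tuple R) i j x :
  j != i -> [set vsub y (s i) | y in voronoi s j] x ->
  0 <= dmin s <= enorm x.
Proof.
have at0 l : 0 <= dmin_at s l.
  rewrite mulr_ge0//.
  by apply: inf_ge0 => _ [k _ <-]; exact: enorm_ge0.
move=> ji [y yV <-{x}]; apply/andP; split.
  by apply: inf_ge0 => _ [k _ <-].
apply: (@le_trans _ _ (dmin_at s i)).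
  by apply: ge_inf; [exists 0 => _ [k _ <-]|exists i].
rewrite ler_pdivrMl//; apply: (@le_trans _ _ (enorm (vsub (s j) (s i)))).
  by apply: ge_inf; [exists 0 => _ [k _ <-]; exact: enorm_ge0|exists j].
rewrite -ler_sqr ?nnegrE ?mulr_ge0 ?enorm_ge0//.
have yji : enorm (vsub y (s j)) ^+ 2 <= enorm (vsub y (s i)) ^+ 2.
  by rewrite ler_sqr ?nnegrE ?enorm_ge0//; exact: yV.
(* A squared triangle inequality: with u = y - s_i and v = y - s_j, |u - v|^2 <= 2 (|u|^2 + |v|^2)
   <= 4 |u|^2. The first bound is coordinatewise, from (u + v)^2 >= 0. *)
apply: (@le_trans _ _ (2 *
  (enorm (vsub y (s i)) ^+ 2 + enorm (vsub y (s j)) ^+ 2))); last by nra.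
rewrite !enormE -big_split mulr_sumr ler_sum// => k _.
rewrite /= !tnth_mktuple.
by have := sqr_ge0 (tnth y k - tnth (s i) k + (tnth y k - tnth (s j) k)); nra.
Qed.

(** * Convexity in P of the density, the error probabilities and the BER *)

Local Open Scope convex_scope.

Lemma noise_pdfE (R : realType) n (P : R) (x : n.-tuple R) : 0 < P ->
  noise_pdf P x = (2 * pi) `^ (- (n%:R / 2)) *
                  exp_ln_inv (n%:R / 2) (enorm x ^+ 2 / 2) P.
Proof.
move=> P0; rewrite /noise_pdf powRM ?mulr_ge0 ?pi_ge0 ?ltW// -mulrA.
rewrite [P `^ _]/powR gt_eqF// -expRD /exp_ln_inv.
by congr (_ * expR (_ - _)); rewrite invfM mulrA.
Qed.

Lemma convex_noise_pdf (R : realType) n (x : n.-tuple R) :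
  convex_function
    ([set P | 0 < P <= enorm x ^+ 2 *
       (n%:R + 2 + Num.sqrt (2 * (n%:R + 2)))^-1] : set R)
    (fun P => noise_pdf P x).
Proof.
move=> t a b; wlog ab : t a b / a <= b => [H aD bD|].
  have [ab|/ltW ba] := leP a b; first exact: H.
  by rewrite convC [leRHS]convC; exact: H.
rewrite !inE /= => /andP[a0 _] /andP[b0 bx].
rewrite !noise_pdfE// ?convR_gt0// !convRE !(mulrCA _ (_ `^ _)) -mulrDr.
rewrite ler_wpM2l ?powR_ge0//; apply: convex_exp_ln_inv => //.
(* Here 2 (n + 2) = 4 (k + 1) with k = n/2, which yields the constant of the theorem. *)
have -> : n%:R / 2 + 1 + Num.sqrt (n%:R / 2 + 1) =
    (n%:R + 2 + Num.sqrt (2 * (n%:R + 2))) / 2 :> R.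
  rewrite (_ : 2 * (n%:R + 2) = 2 ^+ 2 * (n%:R / 2 + 1)); last by field.
  by rewrite sqrtrM// sqrtr_sqr ger0_norm//; field.
by rewrite mulrAC ler_wpM2r// ler_pdivlMr// mulrC -ler_pdivlMr//.
Qed.

(** The domain of integration does not depend on P, so pointwise convexity of the density passes to
    the integral. *)
Lemma convex_pairwise_error (R : realType) n M (s : 'I_M -> n.-tuple R) i j :
  j != i ->
  convex_function
    ([set P | 0 < P <= dmin s ^+ 2 *
       (n%:R + 2 + Num.sqrt (2 * (n%:R + 2)))^-1] : set R)
    (pairwise_error s i j).
Proof.
move=> ji t a b; rewrite !inE => aD bD.
have /andP[a0 _] := aD; have /andP[b0 _] := bD.
have c0 : 0 < (a : R^o) <| t |> b by exact: convR_gt0.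
have mV := measurable_voronoi_shift _ _ _ s i j.
have intN P : 0 < P -> (lebesgue_tuple R n).-integrable
    [set vsub y (s i) | y in voronoi s j] (EFin \o noise_pdf P).
  by move=> P0; exact: integrable_noise_pdf.
have intZ r P : 0 < P -> (lebesgue_tuple R n).-integrable
    [set vsub y (s i) | y in voronoi s j] (EFin \o (fun x => r * noise_pdf P x)).
  by move=> P0; exact: (integrableZl mV r (intN _ P0)).
rewrite convRE /pairwise_error -!RintegralZl//; try exact: intN.
rewrite -RintegralD//; try exact: intZ.
apply: le_Rintegral => //; first exact: intN.
  exact: (integrableD mV (intZ _ _ a0) (intZ _ _ b0)).
move=> x Vx; have /andP[d0 dx] := dmin_le_enorm _ _ _ _ _ _ _ ji Vx.
have sub (P : R) : 0 < P <= dmin s ^+ 2 *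
      (n%:R + 2 + Num.sqrt (2 * (n%:R + 2)))^-1 ->
    P \in [set P : R | 0 < P <= enorm x ^+ 2 *
      (n%:R + 2 + Num.sqrt (2 * (n%:R + 2)))^-1].
  rewrite inE /= => /andP[-> /le_trans]; apply.
  rewrite ler_wpM2r ?invr_ge0 ?addr_ge0 ?sqrtr_ge0 ?lerXn2r ?nnegrE//.
  exact: le_trans dx.
exact: (convex_noise_pdf _ _ x t _ _ (sub _ aD) (sub _ bD)).
Qed.

Theorem corollary5p1 (R : realType) (n M m : nat)
    (s : 'I_M -> n.-tuple R)
    (bits : 'I_M -> m.-tuple bool)
    (prior : 'I_M -> R) :
  (1 <= n)%N -> (2 <= M)%N ->
  injective s ->
  M%:R^-1 * (\sum_(k < M) enorm (s k) ^+ 2) = 1 ->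
  (forall i, 0 <= prior i) -> \sum_(i < M) prior i = 1 ->
  convex_function
    ([set P | 0 < P <= dmin s ^+ 2 *
       (n%:R + 2 + Num.sqrt (2 * (n%:R + 2)))^-1] : set R)
    (BER s bits prior).
Proof.
move=> _ M2 _ _ prior0 _ t a b aD bD.
rewrite convRE /BER !mulr_sumr -big_split; apply: ler_sum => i _ /=.
rewrite !mulr_sumr -big_split; apply: ler_sum => j ji /=.
(* The weights do not depend on P and are nonnegative, as ln M >= 0. *)
rewrite !(mulrCA _ (_ * prior i)) -mulrDr ler_wpM2l//.
  rewrite mulr_ge0// divr_ge0// divr_ge0// ln_ge0 ?ler1n//.
  exact: leq_trans M2.
exact: (convex_pairwise_error _ _ _ _ _ _ ji t _ _ aD bD).
Qed.
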